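(* (1) For all $n\ge 1$, the number of permutations $\sigma\in S_n(231)$ with $\mathrm{maxdrop}(\sigma)\le 1$ equals $2^{n-1}$. (2) For all $r\ge 1$ and $n\ge 2r$, the number of permutations $\sigma\in S_n(231)$ with $\mathrm{maxdrop}(\sigma)\le 1$ and $\mathrm{des}(\sigma)=r$ equals $\binom{n}{2r}$.
   Context: For a permutation $\sigma=\sigma_1\cdots\sigma_n$ of $[n]$, $\mathrm{des}(\sigma)$ is the number of $i\in[n-1]$ with $\sigma_i>\sigma_{i+1}$, and $\mathrm{maxdrop}(\sigma)=\max\{i-\sigma_i : i\in[n]\}$. $S_n(231)$ is the set of permutations of $[n]$ with no indices $a<b<c$ such that $\sigma_c<\sigma_a<\sigma_b$. *)

(* Defs.v *)
From mathcomp Require Import all_boot all_order all_algebra all_fingroup.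
From mathcomp Require Import zify.

Set Implicit Arguments.
Unset Strict Implicit.
Unset Printing Implicit Defensive.

(* Permutations of [n] are represented by 'S_n, acting on {0, ..., n-1}: both
   positions and values are shifted by one, which leaves all comparisons and
   all differences i - s i unchanged. *)

Definition des n (s : 'S_n) : nat :=
  #|[set i : 'I_n | [exists j : 'I_n, (j == i.+1 :> nat) && (s j < s i)]]|.

(* The subtraction is truncated, but the last position has a nonnegative drop,
   so this is the maximum of the signed differences when n > 0: see maxdropP. *)
Definition maxdrop n (s : 'S_n) : nat := \max_(i < n) (i - s i).

Lemma maxdropP n (s : 'S_n) : 0 < n ->
  (forall i : 'I_n, ((i : int) - (s i : int) <= (maxdrop s : int))%R) /\
  (exists i : 'I_n, ((i : int) - (s i : int))%R = (maxdrop s : int)).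
Proof.
case: n s => [//|n] s _.
have ub (i : 'I_n.+1) : i - s i <= maxdrop s by exact: (leq_bigmax i).
split=> [i|]; first by have := ub i; lia.
have [i Ei] : {i : 'I_n.+1 | maxdrop s = i - s i}.
  by apply: eq_bigmax; rewrite card_ord.
have [le_si|lt_is] := leqP (s i) i; first by exists i; lia.
exists ord_max; have := ub ord_max; have := ltn_ord (s ord_max).
by move=> /=; lia.
Qed.

Definition avoiding231 n : {set 'S_n} :=
  [set s : 'S_n | ~~ [exists a : 'I_n, exists b : 'I_n, exists c : 'I_n,
     [&& a < b, b < c, s c < s a & s a < s b]]].

(* Main.v *)
(* A permutation (0-based) of maximal drop at most 1 has the value 0 in position
   0 or 1, and deleting it leaves a permutation with the same property.
   Conversely 0 can be inserted in either position, which gives the powers of 2;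
   avoidance of 231 is automatic, as the final letter of an occurrence is
   preceded by two larger ones, so that it is never the 0 in position 0 or 1.
   An insertion in position 0 gives no initial descent and keeps [des]; an
   insertion in position 1 gives an initial descent, and increases [des] exactly
   when there was none before. So, with [r] descents in size [n + 1], there are
   'C(n, 2r - 1) permutations with an initial descent and 'C(n, 2r) without,
   by Pascal's rule. *)
Require Import Defs.
From mathcomp Require Import all_boot all_fingroup.
From mathcomp Require Import zify.

Lemma maxdrop_le1P n (s : 'S_n) :
  reflect (forall i : 'I_n, i <= (s i).+1) (maxdrop s <= 1).
Proof.
apply: (iffP (bigmax_leqP _ _ _)) => [H i | H i _].
  by have := H i isT; lia.
by have := H i; lia.
Qed.

Lemma lift_perm_surj n (s : 'S_n.+1) (p : 'I_n.+1) :
  exists t : 'S_n, s = lift_perm p (s p) t.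
Proof.
(* The default [k] is never reached: [s] is injective, so [s (lift p k)] differs from [s p]. *)
pose f k := odflt k (unlift (s p) (s (lift p k))).
have fE k : lift (s p) (f k) = s (lift p k).
  rewrite /f; have ne : s p != s (lift p k) by rewrite (inj_eq perm_inj) neq_lift.
  by have [j -> ->] := unlift_some ne.
have f_inj : injective f.
  move=> i j eq_f; apply: (@lift_inj _ p); apply: (@perm_inj _ s).
  by rewrite -!fE eq_f.
exists (perm f_inj); apply/permP=> i.
by case: (unliftP p i) => [k|] ->; rewrite ?lift_perm_id // lift_perm_lift permE fE.
Qed.

Lemma lift_perm_inj n (p q : 'I_n.+1) : injective (@lift_perm n p q).
Proof.
move=> s t eq_st; apply/permP=> k; apply: (@lift_inj _ q).
by rewrite -!(lift_perm_lift p) eq_st.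
Qed.

(** Entries from position [p] on move up by one in position and in value, so their drop is kept.
    Only an entry at position 0 can precede [p], and its drop is never positive. *)
Lemma maxdrop_lift n (p : 'I_n.+2) (s : 'S_n.+1) : p <= 1 ->
  (maxdrop (lift_perm p ord0 s) <= 1) = (maxdrop s <= 1).
Proof.
move=> le_p1; apply/maxdrop_le1P/maxdrop_le1P => H i.
  have := H (lift p i); rewrite lift_perm_lift !lift0 /= /bump.
  by have := ltn_ord (s i); case: leqP; lia.
case: (unliftP p i) => [k|] ->; last by rewrite lift_perm_id.
by rewrite lift_perm_lift lift0 /= /bump; have := H k; lia.
Qed.

Lemma maxdrop_le1_lift n (s : 'S_n.+2) : maxdrop s <= 1 ->
  exists2 p : 'I_n.+2, p <= 1 &
  exists2 t : 'S_n.+1, maxdrop t <= 1 & s = lift_perm p ord0 t.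
Proof.
move=> drop_s; pose p := (s^-1)%g ord0.
have sp : s p = ord0 by rewrite permKV.
have le_p1 : p <= 1 by move/maxdrop_le1P/(_ p): drop_s; rewrite sp.
exists p => //; have [t def_s] := lift_perm_surj _ s p; rewrite sp in def_s.
by exists t; rewrite // -(maxdrop_lift _ p) // -def_s.
Qed.

Lemma maxdrop_le1_avoiding231 n (s : 'S_n) :
  maxdrop s <= 1 -> s \in avoiding231 n.
Proof.
rewrite inE => drop_s; apply/existsP=> -[a /existsP[b /existsP[c]]].
case/and4P; case: n => [|n] in s drop_s a b c *; first by case: a.
elim: n => [|n IHn] in s drop_s a b c *; first by rewrite !ord1.
have [p le_p1 [t drop_t ->]] := maxdrop_le1_lift _ _ drop_s.
(* The inserted 0 is outside the occurrence: [c] is at least 2, and the values at [a] and [b] exceed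
   another one. So the occurrence comes from [t]. *)
case: (unliftP p c) => [k|] ->; last by lia.
rewrite lift_perm_lift lift0.
case: (unliftP p a) => [i|] ->; last by rewrite lift_perm_id.
case: (unliftP p b) => [j|] ->; last by rewrite lift_perm_id.
rewrite !lift_perm_lift !lift0 /= => lt_ij lt_jk.
by apply: (IHn t drop_t i j k); move: lt_ij lt_jk; rewrite /bump; lia.
Qed.

Definition is_descent n (s : 'S_n) (i : 'I_n) : bool :=
  [exists j : 'I_n, (j == i.+1 :> nat) && (s j < s i)].

Lemma is_descentE n (s : 'S_n) (i j : 'I_n) :
  j = i.+1 :> nat -> is_descent n s i = (s j < s i).
Proof.
move=> def_j; apply/existsP/idP => [[k /andP[/eqP def_k]]|lt_s].
  by have -> : k = j by apply: val_inj; rewrite /= def_k def_j.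
by exists j; rewrite def_j eqxx.
Qed.

Lemma is_descent_last n (s : 'S_n) (i : 'I_n) :
  n <= i.+1 -> is_descent n s i = false.
Proof.
by move=> le_n; apply/existsP=> -[j /andP[/eqP def_j _]]; have := ltn_ord j; lia.
Qed.

Lemma desE n (s : 'S_n) : des s = \sum_(i < n) is_descent n s i.
Proof. by rewrite /des -sum1dep_card big_mkcond. Qed.

(** Neighbours from [p] on shift together and keep their order. For [p <= i], [lift ord0 i] is
    [lift p i]; the former is what [big_ord_recl] produces. *)
Lemma is_descent_lift n (p : 'I_n.+2) (s : 'S_n.+1) (i : 'I_n.+1) : p <= i ->
  is_descent n.+2 (lift_perm p ord0 s) (lift ord0 i) = is_descent n.+1 s i.
Proof.
move=> le_pi.
have liftE (k : 'I_n.+1) : p <= k -> lift ord0 k = lift p k.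
  by move=> le_pk; apply: val_inj; rewrite /= /bump le_pk.
have [le_ni | lt_in] := leqP n i.
  by rewrite !is_descent_last // lift0.
have lt_jn : i.+1 < n.+1 by [].
pose j := Ordinal lt_jn.
rewrite (is_descentE _ _ i j) // (is_descentE _ _ _ (lift ord0 j)) ?lift0 //.
by rewrite !liftE ?lift_perm_lift ?lift0 //= ltnW.
Qed.

Lemma is_descent_lift0 n (s : 'S_n.+1) :
  is_descent n.+2 (lift_perm ord0 ord0 s) ord0 = false.
Proof. by rewrite (is_descentE _ _ _ (lift ord0 ord0)) // lift_perm_id. Qed.

Lemma is_descent_lift1 n (s : 'S_n.+1) :
  is_descent n.+2 (lift_perm (inord 1) ord0 s) ord0.
Proof.
rewrite (is_descentE _ _ _ (inord 1)) ?inordK // lift_perm_id.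
have lift1_ord0 : lift (inord 1 : 'I_n.+2) ord0 = ord0.
  by apply: val_inj; rewrite /= /bump inordK.
by rewrite -[X in lift_perm _ _ _ X]lift1_ord0 lift_perm_lift lift0.
Qed.

Lemma des_lift0 n (s : 'S_n.+1) : des (lift_perm ord0 ord0 s) = des s.
Proof.
rewrite !desE big_ord_recl is_descent_lift0 add0n.
by apply: eq_bigr => i _; rewrite is_descent_lift.
Qed.

(** Position 0 becomes a descent, position 1 holds 0 and is none, and the later ones copy positions
    1 and up of [s]: the initial term of [des s] is traded for a 1. *)
Lemma des_lift1 n (s : 'S_n.+1) :
  des (lift_perm (inord 1) ord0 s) = des s + ~~ is_descent n.+1 s ord0.
Proof.
have second : is_descent n.+2 (lift_perm (inord 1) ord0 s) (lift ord0 ord0) = false.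
  have -> : lift ord0 ord0 = inord 1 :> 'I_n.+2.
    by apply: val_inj; rewrite /= inordK.
  by apply/existsP=> -[j]; rewrite lift_perm_id andbF.
rewrite !desE big_ord_recl is_descent_lift1 big_ord_recl second big_ord_recl.
rewrite (eq_bigr (fun i => is_descent n.+1 s (lift ord0 i) : nat)).
  by case: is_descent => /=; lia.
by move=> i _; rewrite is_descent_lift // inordK.
Qed.

Definition drop1 n := [set s : 'S_n | maxdrop s <= 1].

(** An initial descent reveals where the 0 sits, so fixing [b] fixes the insertion position, and
    insertion there is injective. *)
Lemma drop1_split n (P : pred 'S_n.+2) (b : bool) :
  #|[set s in drop1 n.+2 | (is_descent _ s ord0 == b) && P s]| =
  #|[set s in drop1 n.+1 | P (lift_perm (if b then inord 1 else ord0) ord0 s)]|.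
Proof.
set p : 'I_n.+2 := if b then _ else _.
have le_p1 : p <= 1 by rewrite /p; case: b {p} => //; rewrite inordK.
rewrite -(card_imset _ (lift_perm_inj _ p ord0)); apply: eq_card => s.
rewrite !inE; apply/andP/imsetP => [[drop_s /andP[/eqP desc Ps]] | [t]].
  have [q le_q1 [t drop_t def_s]] := maxdrop_le1_lift _ _ drop_s.
  suff def_q : q = p.
    by exists t; rewrite -def_q // !inE drop_t -def_s.
  apply: val_inj; case: (leqP q 0) => [q0|q1].
    have qE : q = ord0 by apply: val_inj => /=; lia.
    by rewrite /p -desc def_s qE is_descent_lift0.
  have qE : q = inord 1 by apply: val_inj; rewrite /= inordK //; lia.
  by rewrite /p -desc def_s qE is_descent_lift1.
rewrite !inE => /andP[drop_t Pt] ->; rewrite maxdrop_lift // Pt andbT.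
by rewrite drop_t /p; case: (b); rewrite ?is_descent_lift1 ?is_descent_lift0.
Qed.

Lemma card_by_descent n (P : pred 'S_n.+1) :
  #|[set s in drop1 n.+1 | P s]| =
  #|[set s in drop1 n.+1 | (is_descent _ s ord0 == true) && P s]| +
  #|[set s in drop1 n.+1 | (is_descent _ s ord0 == false) && P s]|.
Proof.
rewrite -(cardsID [set s | is_descent _ s ord0]).
by congr (_ + _); apply: eq_card => s; rewrite !inE;
   case: is_descent; rewrite ?andbT ?andbF.
Qed.

Lemma card_drop1 n : #|drop1 n.+1| = 2 ^ n.
Proof.
have dropT m : drop1 m = [set s in drop1 m | predT s].
  by apply/setP=> s; rewrite !inE andbT.
elim: n => [|n IHn].
  rewrite (_ : drop1 1 = setT) ?cardsT ?card_Sn //.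
  by apply/setP=> s; rewrite !inE; apply/maxdrop_le1P=> i; rewrite ord1.
by rewrite dropT card_by_descent !drop1_split -dropT IHn expnS mul2n addnn.
Qed.

(** Each count in the next size draws on both, hence the joint induction. The match on [r] is needed
    as a truncated [2 * r - 1] would give 1 rather than 0 at [r = 0]. *)
Lemma card_drop1_des n r :
  #|[set s in drop1 n.+1 | (is_descent _ s ord0 == true) && (des s == r)]| =
    (if r is r'.+1 then 'C(n, (2 * r').+1) else 0) /\
  #|[set s in drop1 n.+1 | (is_descent _ s ord0 == false) && (des s == r)]| =
    'C(n, 2 * r).
Proof.
elim: n r => [|n IHn] r.
  have desc (s : 'S_1) : is_descent 1 s ord0 = false by rewrite is_descent_last.
  have des0 (s : 'S_1) : des s = 0 by rewrite desE big_ord1 desc.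
  split.
    rewrite (_ : [set _ in _ | _] = set0) ?cards0; first by case: r.
    by apply/setP=> s; rewrite !inE desc andbF.
  case: r => [|r].
    rewrite (_ : [set _ in _ | _] = drop1 1) ?card_drop1 //.
    by apply/setP=> s; rewrite !inE desc des0 !andbT.
  rewrite (_ : [set _ in _ | _] = set0) ?cards0 //.
  by apply/setP=> s; rewrite !inE des0 !andbF.
split; last first.
  (* With 0 in front [des] is kept, so both classes with [r] descents add up; for positive [r] this
     is Pascal's rule. *)
  rewrite drop1_split.
  rewrite (eq_card (B := [set s in drop1 n.+1 | des s == r])); last first.
    by move=> s; rewrite !inE des_lift0.
  rewrite card_by_descent !(IHn r).1 !(IHn r).2.
  by case: r => [|r]; rewrite ?muln0 ?bin0 // mulnS binS addnC.
rewrite drop1_split.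
pose d (s : 'S_n.+1) := des s + ~~ is_descent n.+1 s ord0.
rewrite (eq_card (B := [set s in drop1 n.+1 | d s == r])); last first.
  by move=> s; rewrite !inE des_lift1.
rewrite /d {d}.
rewrite card_by_descent.
case: r => [|r].
  apply/eqP; rewrite addn_eq0; apply/andP; split; last first.
    by rewrite cards_eq0; apply/eqP/setP=> s; rewrite !inE;
       case: is_descent; rewrite ?addn1 ?andbF.
  apply/eqP; rewrite -[RHS](IHn 0).1; apply: eq_card => s; rewrite !inE.
  by case: is_descent; rewrite ?addn0.
(* With 0 in position 1, an initial descent keeps [des] and its absence adds one: the classes for
   [r.+1] and [r] enter Pascal's rule. *)
rewrite binS -(IHn r.+1).1 -(IHn r).2.
by congr (_ + _); apply: eq_card => s; rewrite !inE;
   case: is_descent; rewrite ?addn0 ?addn1 ?eqSS.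
Qed.

Theorem theorem2 :
  (forall n : nat, 1 <= n ->
     #|[set s in avoiding231 n | maxdrop s <= 1]| = 2 ^ (n - 1)) /\
  (forall r n : nat, 1 <= r -> 2 * r <= n ->
     #|[set s in avoiding231 n | (maxdrop s <= 1) && (des s == r)]|
       = 'C(n, 2 * r)).
Proof.
(* The bound on the drop implies avoidance, so both counts are over [drop1]. *)
have memE n (s : 'S_n) : (s \in avoiding231 n) && (maxdrop s <= 1) = (s \in drop1 n).
  rewrite [s \in drop1 n]inE.
  by case: (boolP (maxdrop s <= 1)) => [/maxdrop_le1_avoiding231 ->|]; rewrite ?andbF.
split=> [[//|n] _ | [//|r] [|n] _ le_rn].
- by rewrite subn1 -card_drop1; apply: eq_card => s; rewrite inE memE.
- by move: le_rn; rewrite mulnS.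
- have [card_desc card_nodesc] := card_drop1_des n r.+1.
  rewrite (eq_card (B := [set s in drop1 n.+1 | des s == r.+1])); last first.
    by move=> s; rewrite [LHS]inE andbA memE [RHS]inE.
  by rewrite card_by_descent card_desc card_nodesc mulnS binS addnC.
Qed.
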